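(* Let $k\ge1$ and let $G$ and $G'$ be graphs, where $G'$ has no isolated vertices. Suppose that $G$ is $3$-connected, that $M_k(G)$ has at least one circuit, that $s(x,G)\le\rho^*_k(G)$ for every vertex $x$ of $G$, and that $M_k(G')=M_k(G)$. Then $\mathcal{S}(G)=\mathcal{S}(G')$, i.e. $G$ and $G'$ are strongly isomorphic.
   Context: Graphs are finite and may have loops and parallel edges, except that a $3$-connected graph means a simple graph with at least $4$ vertices that stays connected after deletion of any set of at most $2$ vertices. For $X\subseteq E(G)$, $G\langle X\rangle$ is the subgraph of $G$ with edge set $X$ whose vertices are the end-vertices of edges in $X$. $\Delta G=|E(G)|-|V(G)|$. $\mathcal{G}_{\bowtie}$ is the set of graphs having no isolated vertices, no leaves (vertices of degree 1, a loop contributing 2 to the degree), and no cycle components (components that are cycles; a vertex with a single loop is a cycle, and two parallel edges form a cycle). For $k\ge1$ the $k$-circular matroid $M_k(G)$ is the matroid on $E(G)$ whose circuits are the sets $C\subseteq E(G)$ with $\Delta G\langle C\rangle=k$ and $G\langle C\rangle\in\mathcal{G}_{\bowtie}$ (these are known to be the circuits of a matroid). $\rho^*_k(G)$ is the corank of $M_k(G)$, i.e. $|E(G)|$ minus the rank of $M_k(G)$. Equality $M_k(G)=M_k(G')$ means equality of ground sets $E(G)=E(G')$ and of the families of circuits. $S(x,G)$ is the set of edges of $G$ incident to $x$ (loops included), $s(x,G)=|S(x,G)|$, and $\mathcal{S}(G)=\{S(x,G):x\in V(G)\}$. Graphs $G=(V,E,\phi)$ and $G'=(V',E,\phi')$ with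 the same edge set are strongly isomorphic if there is a bijection $\nu:V\to V'$ such that for each edge $e$: $\phi(e)=\{x,y\}\Leftrightarrow\phi'(e)=\{\nu(x),\nu(y)\}$, where $\phi(e)$ is the set of end-vertices of $e$. *)

(* Defs.v *)
From mathcomp Require Import all_boot all_algebra.

Set Implicit Arguments.
Unset Strict Implicit.
Unset Printing Implicit Defensive.

(* Finite graphs, loops and parallel edges allowed.  The vertex set and the   *)
(* edge set are subsets of ambient finite types V and E, so that a graph and  *)
(* its subgraphs, or two graphs with a common edge set, can be compared       *)
(* directly.  A loop at x has ends [set x]; ends e is junk for e outside      *)
(* edges.                                                                     *)
Record mgraph (V E : finType) := MGraph {
  verts : {set V};
  edges : {set E};
  ends : E -> {set V};
  mgraphP : forall e, e \in edges ->
    (ends e \subset verts) && (0 < #|ends e| <= 2)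
}.

Section Graph.
Variables V E : finType.
Implicit Types (G : mgraph V E) (A S : {set V}) (X : {set E}) (x y : V).

Definition incident G x : {set E} := [set e in edges G | x \in ends G e].

Definition num_incident G x : nat := #|incident G x|.

Definition vertex_stars G : {set {set E}} := [set incident G x | x in verts G].

(* Loops are counted once more, so that each contributes 2. *)
Definition degree G x : nat :=
  #|incident G x| + #|[set e in edges G | ends G e == [set x]]|.

Definition isolated G x : bool := incident G x == set0.

Definition leaf G x : bool := degree G x == 1.

Definition no_isolated G : bool := [forall x in verts G, ~~ isolated G x].

Definition no_leaf G : bool := [forall x in verts G, ~~ leaf G x].

Definition adjacent G : rel V :=
  [rel x y | [exists e in edges G, (x \in ends G e) && (y \in ends G e)]].

Definition connected G : bool :=
  [forall x in verts G, forall y in verts G, connect (adjacent G) x y].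

Lemma induced_subproof G A e : e \in [set e in edges G | ends G e \subset A] ->
  (ends G e \subset verts G :&: A) && (0 < #|ends G e| <= 2).
Proof.
rewrite inE => /andP[/mgraphP/andP[sV card_e] sA].
by rewrite subsetI sV sA.
Qed.

Definition induced G A : mgraph V E := MGraph (@induced_subproof G A).

Definition delete_verts G S : mgraph V E := induced G (~: S).

Lemma edge_subgraph_subproof G X e : e \in X :&: edges G ->
  (ends G e \subset \bigcup_(f in X :&: edges G) ends G f)
  && (0 < #|ends G e| <= 2).
Proof.
move=> eX; rewrite (bigcup_sup e) //=.
by move: eX; rewrite inE => /andP[_ /mgraphP/andP[]].
Qed.

(* The subgraph G<X>; elements of X that are not edges of G are ignored. *)
Definition edge_subgraph G X : mgraph V E :=
  MGraph (@edge_subgraph_subproof G X).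

Definition Delta G : int := (#|edges G|%:Z - #|verts G|%:Z)%R.

Definition component G x : mgraph V E :=
  induced G [set y | connect (adjacent G) x y].

Definition is_cycle G : bool :=
  [&& verts G != set0, connected G & [forall x in verts G, degree G x == 2]].

Definition no_cycle_component G : bool :=
  [forall x in verts G, ~~ is_cycle (component G x)].

(* The class written $\mathcal{G}_{\bowtie}$. *)
Definition bowtie G : bool :=
  [&& no_isolated G, no_leaf G & no_cycle_component G].

Definition simple G : Prop :=
  {in edges G, forall e, #|ends G e| = 2} /\ {in edges G &, injective (ends G)}.

Definition three_connected G : Prop :=
  [/\ simple G, 4 <= #|verts G| &
      forall S, S \subset verts G -> #|S| <= 2 -> connected (delete_verts G S)].

End Graph.

(* A matroid presented by its ground set and its family of circuits; the      *)
(* circuit axioms are not part of the record.                                 *)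
Record circuit_system (E : finType) := CircuitSystem {
  ground : {set E};
  circuits : {set {set E}}
}.

Definition independent (E : finType) (M : circuit_system E) (I : {set E}) :=
  (I \subset ground M) && [forall C in circuits M, ~~ (C \subset I)].

Definition rank (E : finType) (M : circuit_system E) : nat :=
  \max_(I : {set E} | independent M I) #|I|.

Definition corank (E : finType) (M : circuit_system E) : nat :=
  #|ground M| - rank M.

Definition circular_matroid (V E : finType) (k : nat) (G : mgraph V E) :=
  CircuitSystem (edges G)
    [set C : {set E} | [&& C \subset edges G,
                           Delta (edge_subgraph G C) == k%:Z%R
                         & bowtie (edge_subgraph G C)]].

Definition strongly_isomorphic (V V' E : finType)
    (G : mgraph V E) (G' : mgraph V' E) : Prop :=
  edges G = edges G' /\
  exists nu : V -> V',
    [/\ {in verts G &, injective nu}, nu @: verts G = verts G' &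
        forall e, e \in edges G ->
          {in verts G &, forall x y,
             ends G e = [set x; y] <-> ends G' e = [set nu x; nu y]}].

(* Main.v *)
(* Write m = k - 1.  A set X of edges is independent in M_k(G) iff every Y <= X
   has |Y| <= |V(Y)| + m, and if X is a union of circuits then its rank is
   |V(X)| + m.  For a vertex x of the 3-connected graph G let H be the complement
   of the star of x.  The bound on s(x, G) gives |H| >= |V(G - x)| + k, and since
   G - x is 2-edge-connected every edge of H lies in a circuit inside H.  Hence
   both E and H are unions of circuits, so the rank reads off |V(X)| for these
   sets in every graph representing M_k(G): |V(G')| = |V(G)|, and H covers all
   vertices of G' but one, x'.  As H is closed in M_k(G), each edge of the star of
   x is incident to x', so S(x', G') = S(x, G). *)
Require Import Defs.
From mathcomp Require Import all_boot all_algebra zify.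

Set Implicit Arguments.
Unset Strict Implicit.
Unset Printing Implicit Defensive.

Ltac card_lia :=
  clear; repeat match goal with |- context [card ?A] => generalize (card A); intro end; lia.

(** * Sparse edge sets and their bases *)

Section Sparse.
Variables (V E : finType) (f : E -> {set V}) (m : nat).
Implicit Types (X Y Z I : {set E}) (W U : {set V}).

Definition shadow X : {set V} := \bigcup_(e in X) f e.

(** For [m] $= k-1$ this is the independence condition of $M_k$. Below, [X] is called tight if
    [#|shadow X| + m <= #|X|]; for a sparse set this is an equality. *)
Definition sparse X : bool := [forall Y : {set E}, (Y \subset X) ==> (#|Y| <= #|shadow Y| + m)].

Lemma sparseP X : reflect (forall Y, Y \subset X -> #|Y| <= #|shadow Y| + m) (sparse X).
Proof. exact: 'forall_implyP. Qed.

Lemma shadowP X v : reflect (exists2 e, e \in X & v \in f e) (v \in shadow X).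
Proof. exact: bigcupP. Qed.

Lemma shadowS X Y : X \subset Y -> shadow X \subset shadow Y.
Proof.
move=> /subsetP XY; apply/subsetP => v /shadowP[e eX ve].
by apply/shadowP; exists e => //; apply: XY.
Qed.

Lemma shadowU X Y : shadow (X :|: Y) = shadow X :|: shadow Y.
Proof. exact: bigcup_setU. Qed.

Lemma shadow1 e : shadow [set e] = f e.
Proof. exact: big_set1. Qed.

Lemma sparseS X Y : X \subset Y -> sparse Y -> sparse X.
Proof.
by move=> XY /sparseP sY; apply/sparseP => Z /subset_trans/(_ XY); apply: sY.
Qed.

(** The new vertex [v] pays for [e]: a subset of [e |: I] that contains [e] loses both when [e] is
    removed. *)
Lemma sparse_setU1 I e v : sparse I -> v \in f e -> v \notin shadow I -> sparse (e |: I).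
Proof.
move=> /sparseP sI ve vI; apply/sparseP => Y YeI.
have YI : Y :\ e \subset I by rewrite subDset.
have [eY|eY] := boolP (e \in Y); last first.
  by apply: sI; apply: subset_trans YI; rewrite subsetD1 subxx.
have vY : v \in shadow Y by apply/shadowP; exists e.
have sub : shadow (Y :\ e) \subset shadow Y :\ v.
  rewrite subsetD1 shadowS ?subsetDl //=.
  by apply: contra vI; apply: subsetP; apply: shadowS.
have := subset_leq_card sub; have := sI _ YI.
have := cardsD1 e Y; have := cardsD1 v (shadow Y); rewrite eY vY; card_lia.
Qed.

(** An inclusion-minimal tight subset is sparse: a violating [Y] inside it would stay tight after
    the loss of one edge, against minimality. *)
Lemma sparse_tight_exists X :
  #|shadow X| + m <= #|X| ->
  exists I : {set E}, [/\ I \subset X, sparse I & #|shadow I| + m <= #|I|].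
Proof.
move=> hX; pose P := [pred Y : {set E} | #|shadow Y| + m <= #|Y|].
have [I /minsetP[/= tI minI] IX] := @minset_exists _ P X hX.
exists I; split => //; apply/sparseP => Y YI.
rewrite leqNgt; apply/negP => hY.
have [e eY] : exists e, e \in Y by apply/set0Pn; rewrite -card_gt0; move: hY; card_lia.
have cY := cardsD1 e Y; rewrite eY in cY.
have sY := subset_leq_card (shadowS (subsetDl Y [set e])).
have YeI : Y :\ e \subset I := subset_trans (subsetDl _ _) YI.
have Ye : P (Y :\ e) by rewrite /=; move: hY cY sY; card_lia.
have := minI _ Ye YeI => YE.
by have := subsetP YI e eY; rewrite -YE setD11.
Qed.

(** A Hall-type argument: a minimal nonempty [B] inside [Z] with at most [#|B|] vertices outside
    [shadow I] has, by minimality, at least [#|D|] such vertices for each [D \subset B]. Adding [B]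
    to [I] then keeps both sparsity and tightness. *)
Lemma sparse_extend X Z I :
  sparse I -> #|shadow I| + m <= #|I| -> I \subset X -> Z \subset X ->
  Z != set0 -> (forall e, e \in Z -> ~~ (f e \subset shadow I)) ->
  #|shadow Z :\: shadow I| <= #|Z| ->
  exists J : {set E}, [/\ I \proper J, J \subset X, sparse J & #|shadow J| + m <= #|J|].
Proof.
set W := shadow I => sI tI IX ZX Z0 ZW cZ.
pose P := [pred B : {set E} | (B != set0) && (#|shadow B :\: W| <= #|B|)].
have PZ : P Z by rewrite /= Z0.
have [B /minsetP[/= /andP[B0 cB] minB] BZ] := @minset_exists _ P Z PZ.
have small (D : {set E}) : D \subset B -> #|D| <= #|shadow D :\: W|.
  move=> DB; rewrite leqNgt; apply/negP => hD.
  have [e eD] : exists e, e \in D by apply/set0Pn; rewrite -card_gt0; move: hD; card_lia.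
  (* As [D] reaches a vertex outside [W], a violating [D] has at least two edges, so [D :\ e] is
     nonempty. *)
  have eW : 0 < #|shadow D :\: W|.
    rewrite card_gt0; case/subsetPn: (ZW e (subsetP BZ _ (subsetP DB _ eD))) => v ve vW.
    by apply/set0Pn; exists v; rewrite inE vW; apply/shadowP; exists e.
  have cD := cardsD1 e D; rewrite eD in cD.
  have sD := subset_leq_card (setSD W (shadowS (subsetDl D [set e]))).
  have PD : P (D :\ e).
    by rewrite /= -card_gt0; move: hD eW cD sD; card_lia.
  have := minB _ PD (subset_trans (subsetDl _ _) DB) => DE.
  by have := subsetP DB e eD; rewrite -DE setD11.
have IB : [disjoint I & B].
  rewrite disjoints_subset; apply/subsetP => e eI; rewrite inE; apply/negP => eB.
  have /negP := ZW e (subsetP BZ _ eB); apply.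
  by rewrite /W -shadow1; apply: shadowS; rewrite sub1set.
have cIB : #|I :|: B| = #|I| + #|B|.
  by rewrite cardsU disjoint_setI0 // cards0 subn0.
exists (I :|: B); split.
- by rewrite properEcard subsetUl cIB -[X in X < _]addn0 ltn_add2l card_gt0.
- by rewrite subUset IX (subset_trans BZ).
- apply/sparseP => Y YIB.
  have hI : #|Y :&: I| <= #|shadow (Y :&: I)| + m by apply: (sparseP _ sI); apply: subsetIr.
  have hB := small _ (subsetIr Y B).
  have cY : #|Y| <= #|Y :&: I| + #|Y :&: B|.
    rewrite -{1}(setIidPl YIB) setIUr; exact: (leq_card_setU _ _).1.
  (* The vertices of [Y :&: I] lie in [W], the new ones of [Y :&: B] outside it, so the two bounds
     add up. *)
  have dis : [disjoint shadow (Y :&: I) & shadow (Y :&: B) :\: W].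
    rewrite disjoint_sym disjoints_subset setDE; apply: subset_trans (subsetIr _ _) _.
    by rewrite setCS; apply: shadowS; apply: subsetIr.
  have : #|shadow (Y :&: I)| + #|shadow (Y :&: B) :\: W| <= #|shadow Y|.
    rewrite -[X in X <= _]subn0 -(@cards0 V) -(disjoint_setI0 dis) -cardsU.
    apply: subset_leq_card; rewrite subUset (shadowS (subsetIl _ _)).
    by apply: subset_trans (subsetDl _ _) _; apply: shadowS; apply: subsetIl.
  by move: hI hB cY; card_lia.
- have -> : shadow (I :|: B) = W :|: (shadow B :\: W).
    by rewrite shadowU; apply/setP => v; rewrite !inE; case: (v \in W).
  by have := (leq_card_setU W (shadow B :\: W)).1; rewrite cIB; move: tI cB; rewrite -/W; card_lia.
Qed.

(** A maximal tight sparse subset of [X] covers all of [shadow X]: otherwise the edges not inside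
    its shadow could be fed to [sparse_extend]. The set [Y] supplies a first tight sparse set. *)
Lemma sparse_basis X Y :
  (forall W, #|shadow X :\: W| <= #|[set e in X | ~~ (f e \subset W)]|) ->
  Y \subset X -> #|shadow Y| + m <= #|Y| ->
  exists I : {set E}, [/\ I \subset X, sparse I & #|shadow X| + m <= #|I|].
Proof.
move=> hcov YX hY; have [I0 [I0Y sI0 tI0]] := sparse_tight_exists hY.
pose P := [pred I : {set E} | [&& I \subset X, sparse I & #|shadow I| + m <= #|I|]].
have PI0 : P I0 by rewrite /= (subset_trans I0Y YX) sI0.
have [I /maxsetP[/= /and3P[IX sI tI] maxI] _] := @maxset_exists _ P I0 PI0.
exists I; split => //.
have [XI|] := boolP (shadow X \subset shadow I).
  by apply: leq_trans tI; rewrite leq_add2r subset_leq_card.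
rewrite -setD_eq0 -card_gt0 => XI.
pose Z := [set e in X | ~~ (f e \subset shadow I)].
have ZX : Z \subset X by apply/subsetP => e; rewrite inE => /andP[].
have hZ := hcov (shadow I).
have Z0 : Z != set0 by rewrite -card_gt0; apply: leq_trans hZ.
have ZI e : e \in Z -> ~~ (f e \subset shadow I) by rewrite inE => /andP[].
have cZ : #|shadow Z :\: shadow I| <= #|Z|.
  by apply: leq_trans hZ; apply: subset_leq_card; apply: setSD; apply: shadowS.
have [J [IJ JX sJ tJ]] := sparse_extend sI tI IX ZX Z0 ZI cZ.
have JI : J = I by apply: maxI; rewrite /= ?JX ?sJ ?proper_sub.
by rewrite JI properxx in IJ.
Qed.

(** * Double counting of edge ends *)

(* The second summand makes a loop count 2, as in degree. *)
Definition end_count U e : nat := #|f e :&: U| + #|[set v in U | f e == [set v]]|.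

Lemma sum_degree X U :
  \sum_(v in U) (#|[set e in X | v \in f e]| + #|[set e in X | f e == [set v]]|)
  = \sum_(e in X) end_count U e.
Proof.
rewrite !big_split /=; congr (_ + _).
  under eq_bigr => v _ do rewrite -sum1dep_card big_mkcondr.
  rewrite exchange_big /=; apply: eq_bigr => e _.
  by rewrite -big_mkcondr sum1dep_card; apply: eq_card => v; rewrite !inE andbC.
under eq_bigr => v _ do rewrite -sum1dep_card big_mkcondr.
rewrite exchange_big /=; apply: eq_bigr => e _.
by rewrite -big_mkcondr sum1dep_card.
Qed.

Lemma end_count_loops U e x : f e = [set x] -> end_count U e = (x \in U).*2.
Proof.
move=> fe; rewrite /end_count fe.
have -> : [set v in U | [set x] == [set v]] = [set x] :&: U.
  by apply/setP => v; rewrite !inE (inj_eq set1_inj) andbC eq_sym.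
case: (boolP (x \in U)) => xU.
  by rewrite (setIidPl _) ?sub1set // cards1.
by rewrite disjoint_setI0 ?cards0 // disjoints1.
Qed.

Lemma end_count_nonloop U e : #|f e| = 2 -> end_count U e = #|f e :&: U|.
Proof.
move=> fe; rewrite /end_count; apply/eqP; rewrite -[X in _ == X]addn0 eqn_add2l.
rewrite cards_eq0; apply/eqP/setP => v; rewrite !inE; apply/negP => /andP[_ /eqP fv].
by rewrite fv cards1 in fe.
Qed.

Lemma end_count_le2 U e : 0 < #|f e| <= 2 -> end_count U e <= 2.
Proof.
case/andP; rewrite leq_eqVlt => /orP[|].
  by rewrite eq_sym => /cards1P[x fx]; rewrite (end_count_loops _ fx); case: (_ \in _).
move=> gt1 le2; have fe : #|f e| = 2 by move: gt1 le2; card_lia.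
by rewrite end_count_nonloop // -fe subset_leq_card // subsetIl.
Qed.

Lemma end_count_sub U e : 0 < #|f e| <= 2 -> f e \subset U -> end_count U e = 2.
Proof.
case/andP; rewrite leq_eqVlt => /orP[|].
  rewrite eq_sym => /cards1P[x fx] _; rewrite (end_count_loops _ fx) fx sub1set.
  by move=> ->.
move=> gt1 le2 fU; have fe : #|f e| = 2 by move: gt1 le2; card_lia.
by rewrite end_count_nonloop // (setIidPl fU).
Qed.

Lemma end_count_out U e : 0 < #|f e| -> f e :&: U = set0 -> end_count U e = 0.
Proof.
move=> f0 fU; rewrite /end_count fU cards0 add0n; apply/eqP.
rewrite cards_eq0; apply/eqP/setP => v; rewrite !inE; apply/negP => /andP[vU /eqP fv].
by move/setP/(_ v): fU; rewrite fv !inE eqxx vU.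
Qed.

Definition crossing X U : {set E} :=
  [set e in X | (f e :&: U != set0) && ~~ (f e \subset U)].

(** A crossing edge is not a loop and has just one end in [U], which leaves a slack of 1 below the
    maximal count 2. *)
Lemma end_count_crossing U e : 0 < #|f e| <= 2 ->
  end_count U e + ((f e :&: U != set0) && ~~ (f e \subset U)) <= (f e :&: U != set0) * 2.
Proof.
move=> fe; have [/eqP|meet] := boolP (f e :&: U == set0).
  by move=> out; rewrite end_count_out //; case/andP: fe.
have [sub|nsub] /= := boolP (f e \subset U); first by rewrite addn0 end_count_le2.
rewrite addn1 end_count_nonloop.
  case/andP: fe => _; apply: leq_trans; apply: proper_card.
  by rewrite properE subsetIl subsetI subxx.
case/andP: fe; rewrite leq_eqVlt => /orP[|]; last first.
  by move=> ? ?; apply/eqP; rewrite eqn_leq; apply/andP.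
rewrite eq_sym => /cards1P[x fx]; rewrite fx sub1set in nsub.
by rewrite fx disjoint_setI0 ?eqxx ?disjoints1 in meet.
Qed.

(** The degree sum over [U] is at least [#|U| * 2] and is bounded edge by edge. The slack of the
    crossing edges is kept for [star_complement_del_cover], which must afford the loss of an
    edge. *)
Lemma degree_crossing X U :
  {in X, forall e, 0 < #|f e| <= 2} ->
  {in U, forall v,
     2 <= #|[set e in X | v \in f e]| + #|[set e in X | f e == [set v]]|} ->
  #|U| * 2 + #|crossing X U| <= #|[set e in X | f e :&: U != set0]| * 2.
Proof.
move=> hf hdeg.
apply: (@leq_trans (\sum_(e in X) (f e :&: U != set0) * 2)); last first.
  by rewrite -big_distrl leq_mul2r /= -big_mkcondr sum1dep_card.
apply: leq_trans (leq_sum _ _) => [|e /hf]; last exact: end_count_crossing.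
rewrite big_split leq_add //=; last by rewrite -big_mkcondr sum1dep_card.
by rewrite -sum_degree -sum_nat_const; apply: leq_sum => v /hdeg.
Qed.

(** Apply [degree_crossing] to the vertices outside [W]: an edge meeting them is not inside [W]. *)
Lemma cover_of_degree X :
  {in X, forall e, 0 < #|f e| <= 2} ->
  {in shadow X, forall v,
     2 <= #|[set e in X | v \in f e]| + #|[set e in X | f e == [set v]]|} ->
  forall W, #|shadow X :\: W| <= #|[set e in X | ~~ (f e \subset W)]|.
Proof.
move=> hf hdeg W; set U := shadow X :\: W.
have hU : {in U, forall v,
    2 <= #|[set e in X | v \in f e]| + #|[set e in X | f e == [set v]]|}.
  by move=> v; rewrite inE => /andP[_]; apply: hdeg.
have := leq_trans (leq_addr _ _) (degree_crossing hf hU).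
rewrite leq_pmul2r // => /leq_trans; apply; apply: subset_leq_card.
apply/subsetP => e; rewrite !inE => /andP[-> /set0Pn[v]]; rewrite 2!inE.
by case/and3P=> ve vW _; apply/subsetPn; exists v.
Qed.

End Sparse.

(** * Independent sets and circuits of $M_k(G)$ *)

Section CircularMatroid.
Variables (V E : finType) (G : mgraph V E) (m : nat).
Implicit Types (X Y C I : {set E}).

Local Notation shadow := (shadow (ends G)).
Local Notation sparse := (sparse (ends G) m).
Local Notation M := (circular_matroid m.+1 G).

Lemma card_ends e : e \in edges G -> 0 < #|ends G e| <= 2.
Proof. by case/mgraphP/andP. Qed.

Lemma ends_verts e v : e \in edges G -> v \in ends G e -> v \in verts G.
Proof. by case/mgraphP/andP=> /subsetP sub _; apply: sub. Qed.

Lemma shadow_verts X : X \subset edges G -> shadow X \subset verts G.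
Proof.
move/subsetP=> XG; apply/subsetP => v /shadowP[e /XG eG]; exact: ends_verts.
Qed.

Lemma mem_circuits C :
  (C \in circuits M) =
  [&& C \subset edges G, #|C| == #|shadow C| + m.+1 & bowtie (edge_subgraph G C)].
Proof.
rewrite inE; case: (boolP (C \subset edges G)) => //= CG.
congr (_ && _); rewrite /Delta /= /Defs.edges /= (setIidPl CG) -/(shadow C).
by rewrite GRing.subr_eq -PoszD eqz_nat addnC.
Qed.

Lemma circuit_not_sparse C : C \in circuits M -> ~~ sparse C.
Proof.
rewrite mem_circuits => /and3P[_ /eqP cC _]; apply/negP => /sparseP/(_ _ (subxx C)).
by rewrite cC; card_lia.
Qed.

(** A minimal [C] with at least [#|shadow C| + m.+1] edges is a circuit: a surplus edge, a leaf with
    its edge, or a cycle component could be removed without breaking the inequality. *)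
Lemma circuit_in_dense X : X \subset edges G -> ~~ sparse X ->
  exists2 C, C \in circuits M & C \subset X.
Proof.
move=> XG nsX; pose P := [pred Y : {set E} | #|shadow Y| + m.+1 <= #|Y|].
have [Y YX hY] : exists2 Y : {set E}, Y \subset X & P Y.
  move: nsX; rewrite negb_forall => /existsP[Y]; rewrite negb_imply => /andP[YX].
  by rewrite -ltnNge => hY; exists Y => //=; rewrite addnS.
have [C /minsetP[/= hC minC] CY] := @minset_exists _ P Y hY.
have CX := subset_trans CY YX; have CG := subset_trans CX XG.
have {}minC (D : {set E}) : D \proper C -> #|D| < #|shadow D| + m.+1.
  move=> DC; rewrite ltnNge; apply/negP => hD.
  by move: (DC); rewrite (minC _ hD (proper_sub DC)) properxx.
exists C => //; rewrite mem_circuits CG /=; apply/andP; split.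
  rewrite eqn_leq hC andbT leqNgt; apply/negP => hC'.
  have [e eC] : exists e, e \in C by apply/set0Pn; rewrite -card_gt0; move: hC'; card_lia.
  have := minC _ (properD1 eC); have := cardsD1 e C; rewrite eC.
  have := subset_leq_card (shadowS (ends G) (subsetDl C [set e])); move: hC'; card_lia.
have eK : edges (edge_subgraph G C) = C by apply/setIidPl.
have vK : verts (edge_subgraph G C) = shadow C by rewrite /= (setIidPl CG).
apply/and3P; split.
- apply/forall_inP => v; rewrite vK => /shadowP[e eC ve].
  by apply/set0Pn; exists e; rewrite inE eK eC.
- apply/forall_inP => v; rewrite vK => vC; apply/negP => /eqP.
  rewrite /degree /incident eK /= => deg1.
  have [e eC ve] := shadowP _ _ _ vC.
  have cinc : 0 < #|[set e in C | v \in ends G e]|.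
    by rewrite card_gt0; apply/set0Pn; exists e; rewrite inE eC.
  (* Degree 1 forces a single incident edge, and deleting it also loses [v]. *)
  have /cards1P[e' he'] : #|[set e in C | v \in ends G e]| == 1.
    by rewrite eqn_leq cinc andbT -deg1 leq_addr.
  have sub : shadow (C :\ e) \subset shadow C :\ v.
    apply/subsetP => w /shadowP[d]; rewrite 2!inE => /andP[de dC] wd.
    rewrite !inE; apply/andP; split; last by apply/shadowP; exists d.
    apply: contra de => /eqP wv; subst w.
    have : d \in [set e'] by rewrite -he' inE dC.
    have : e \in [set e'] by rewrite -he' inE eC.
    by rewrite !inE => /eqP-> /eqP->.
  have := minC _ (properD1 eC); have := cardsD1 e C; rewrite eC.
  have := subset_leq_card sub; have := cardsD1 v (shadow C); rewrite vC; move: hC; card_lia.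
apply/forall_inP => x xK; apply/negP => /and3P[_ _ /forall_inP deg2].
set K := edge_subgraph G C in eK vK xK deg2 *.
set L := component K x in deg2.
pose A := [set y | connect (adjacent K) x y].
have closedA e v : e \in C -> v \in ends G e -> v \in A -> ends G e \subset A.
  move=> eC ve vA; apply/subsetP => w we; move: vA; rewrite !inE => xv.
  apply: connect_trans xv (connect1 _).
  by apply/exists_inP; exists e; rewrite ?eK // ve we.
have QC : edges L \subset C.
  by apply/subsetP => e; rewrite inE eK => /andP[].
(* By the handshake count a 2-regular component has as many edges as vertices, so its removal keeps
   the excess of [C]. *)
have cQ : #|edges L| = #|verts L|.
  apply/eqP; rewrite -(eqn_pmul2r (isT : 0 < 2)) -!sum_nat_const; apply/eqP.
  transitivity (\sum_(e in edges L) end_count (ends G) (verts L) e).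
    apply: eq_bigr => e eL; rewrite end_count_sub //.
      by apply: card_ends; apply: (subsetP CG); apply: (subsetP QC).
    by case/mgraphP/andP: eL.
  rewrite -sum_degree; apply: eq_bigr => v vL; exact/eqP/deg2.
have xA : x \in A by rewrite inE connect0.
have [e eC xe] : exists2 e, e \in C & x \in ends G e by move: xK; rewrite vK => /shadowP.
have eQ : e \in edges L by rewrite inE eK eC (closedA e x).
have prop : C :\: edges L \proper C.
  rewrite properE subsetDl; apply/subsetPn; exists e => //.
  by rewrite inE eQ.
have sub : shadow (C :\: edges L) \subset shadow C :\: verts L.
  apply/subsetP => w /shadowP[d]; rewrite inE => /andP[dL dC] wd.
  rewrite inE; apply/andP; split; last by apply/shadowP; exists d.
  apply: contra dL; rewrite inE => /andP[_ wA].
  by rewrite inE eK dC (closedA d w).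
have LC : verts L \subset shadow C by rewrite -vK subsetIl.
have := minC _ prop; have := subset_leq_card sub.
rewrite !cardsD (setIidPr LC) (setIidPr QC).
have := subset_leq_card LC; have := subset_leq_card QC; move: hC cQ; card_lia.
Qed.

Lemma independentE X : independent M X = (X \subset edges G) && sparse X.
Proof.
rewrite /independent [ground _]/=; case: (boolP (X \subset edges G)) => //= XG.
apply/idP/idP.
  move/forall_inP => ind; apply: contraT => /(circuit_in_dense XG)[C /ind nCX CX].
  by rewrite CX in nCX.
move=> sX; apply/forall_inP => C /circuit_not_sparse; apply: contra => CX.
exact: sparseS sX.
Qed.

Lemma circuit_degree C : C \in circuits M ->
  {in shadow C, forall v,
     2 <= #|[set e in C | v \in ends G e]| + #|[set e in C | ends G e == [set v]]|}.
Proof.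
rewrite mem_circuits => /and3P[CG _ /and3P[_ /forall_inP noleaf _]] v vC.
have := noleaf v; rewrite /= (setIidPl CG) => /(_ vC).
rewrite /leaf /degree /incident /= /Defs.edges /= (setIidPl CG) => deg1.
have [e eC ve] := shadowP _ _ _ vC.
have : 0 < #|[set e in C | v \in ends G e]|.
  by rewrite card_gt0; apply/set0Pn; exists e; rewrite inE eC.
by move/eqP: deg1; card_lia.
Qed.

(** Every vertex of a circuit has degree at least 2 in it, hence also in the union [X], which yields
    the covering hypothesis of [sparse_basis]; any one of the circuits is a tight set to start
    from. *)
Lemma circuit_union_basis X :
  X \subset edges G -> X != set0 ->
  {in X, forall e, exists C, [/\ C \in circuits M, C \subset X & e \in C]} ->
  exists I : {set E}, [/\ I \subset X, independent M I & #|shadow X| + m <= #|I|].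
Proof.
move=> XG /set0Pn[e0 e0X] circX.
have [C0 [C0M C0X _]] := circX _ e0X.
have tC0 : #|shadow C0| + m <= #|C0|.
  by move: C0M; rewrite mem_circuits => /and3P[_ /eqP-> _]; card_lia.
have covX : forall W, #|shadow X :\: W| <= #|[set e in X | ~~ (ends G e \subset W)]|.
  apply: cover_of_degree => [e eX|v /shadowP[e eX ve]].
    by apply: card_ends; apply: (subsetP XG).
  have [C [CM CX eC]] := circX _ eX.
  have vC : v \in shadow C by apply/shadowP; exists e.
  apply: leq_trans (circuit_degree CM vC) _.
  by apply: leq_add; apply: subset_leq_card; apply/subsetP => d;
    rewrite !inE => /andP[dC ->]; rewrite (subsetP CX).
have [I [IX sI cI]] := sparse_basis covX C0X tC0.
by exists I; rewrite independentE sI (subset_trans IX XG).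
Qed.

Lemma independent_card I : independent M I -> #|I| <= #|shadow I| + m.
Proof. by rewrite independentE => /andP[_ /sparseP]; apply. Qed.

End CircularMatroid.

(** * Cuts and vertex stars in 3-connected graphs *)

Lemma connected_crossing (V E : finType) (G : mgraph V E) (U : {set V}) u w :
  connected G -> u \in verts G -> w \in verts G -> u \in U -> w \notin U ->
  exists e a b, [/\ e \in edges G, a \in ends G e, b \in ends G e, a \in U & b \notin U].
Proof.
move=> /forall_inP conn uG wG uU wU.
have [cl|] := boolP [forall e in edges G, forall a in ends G e :&: U, ends G e \subset U].
  have /connectP[p pth wE] : connect (adjacent G) u w by move/forall_inP: (conn u uG); apply.
  elim: p u uU pth wE {uG} => [|v p IH] u uU /=; first by move=> _ wu; rewrite wu uU in wU.
  case/andP=> /exists_inP[e eG /andP[ue ve]]; apply: IH.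
  have := forall_inP (forall_inP cl e eG) u; rewrite inE ue uU => /(_ isT)/subsetP; exact.
case/forall_inPn => e eG /forall_inPn[a]; rewrite inE => /andP[ae aU] /subsetPn[b be bU].
by exists e, a, b.
Qed.

Section ThreeConnected.
Variables (V E : finType) (G : mgraph V E).
Implicit Types (X C I : {set E}) (U S : {set V}) (x v : V).

Hypothesis G3 : three_connected G.

Lemma crossing_avoiding S U u w :
  S \subset verts G -> #|S| <= 2 -> u \in verts G :\: S -> w \in verts G :\: S ->
  u \in U -> w \notin U ->
  exists e a b, [/\ e \in edges G, [disjoint ends G e & S],
                    a \in ends G e :&: U & b \in ends G e :\: U].
Proof.
case: G3 => _ _ conn SG cS uS wS uU wU.
have Dv v : v \in verts G :\: S -> v \in verts (delete_verts G S).
  by rewrite !inE andbC.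
have [e [a [b [eD ae be aU bU]]]] :=
  connected_crossing (conn S SG cS) (Dv _ uS) (Dv _ wS) uU wU.
exists e, a, b; move: eD; rewrite !inE => /andP[-> eS].
by rewrite disjoints_subset eS ae aU be bU.
Qed.

(** The set $H$ of the opening comment, that is, the edge set of $G - x$. *)
Definition star_complement x := edges G :\: incident G x.

Lemma star_complementE x e :
  (e \in star_complement x) = (e \in edges G) && (x \notin ends G e).
Proof. by rewrite !inE; case: (e \in edges G); rewrite ?andbF ?andbT. Qed.

Lemma star_complement_sub x : star_complement x \subset edges G.
Proof. exact: subsetDl. Qed.

(** This is the 2-edge-connectedness of $G - x$. Deleting [x] alone leaves one edge across the cut;
    deleting [x] and an end of that edge leaves another. *)
Lemma two_crossing x U :
  x \in verts G -> U \subset verts G :\ x -> U != set0 -> (verts G :\ x) :\: U != set0 ->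
  2 <= #|crossing (ends G) (star_complement x) U|.
Proof.
move=> xG UG /set0Pn[u0 u0U] /set0Pn[w0]; rewrite inE => /andP[w0U w0G].
have sx : [set x] \subset verts G by rewrite sub1set.
have cx : #|[set x]| <= 2 by rewrite cards1.
have [e1 [u1 [w1 [e1G e1x]]]] := crossing_avoiding sx cx (subsetP UG _ u0U) w0G u0U w0U.
rewrite !inE => /andP[u1e u1U] /andP[w1U w1e].
have in_cross e a b : e \in edges G -> x \notin ends G e -> a \in ends G e :&: U ->
    b \in ends G e :\: U -> e \in crossing (ends G) (star_complement x) U.
  move=> eG xe ae; rewrite inE => /andP[bU be]; rewrite inE star_complementE eG xe /=.
  by apply/andP; split; [apply/set0Pn; exists a | apply/subsetPn; exists b].
have e1C : e1 \in crossing (ends G) (star_complement x) U.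
  by apply: (in_cross e1 u1 w1); rewrite ?inE ?u1e ?w1U // -disjoints1 disjoint_sym.
have w1G : w1 \in verts G :\ x.
  rewrite !inE (ends_verts e1G w1e) andbT; apply: contraTneq w1e => ->.
  by rewrite -disjoints1 disjoint_sym.
have u1G := subsetP UG _ u1U.
(* A second crossing edge avoids an end z of the first. *)
suff [z [u [w [zG z1 uU wU [uD wD]]]]] : exists z u w,
    [/\ z \in verts G, z \in ends G e1, u \in U, w \notin U &
        u \in verts G :\: [set x; z] /\ w \in verts G :\: [set x; z]].
  have [||e2 [u2 [w2 [e2G e2D u2e w2e]]]] :=
    @crossing_avoiding [set x; z] U u w _ _ uD wD uU wU.
  - by rewrite subUset !sub1set xG.
  - by rewrite cards2; case: (_ == _).
  move: e2D; rewrite disjoint_sym disjoints_subset subUset !sub1set !inE => /andP[xe2 ze2].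
  apply/card_gt1P; exists e1, e2; split => //; first exact: in_cross u2e w2e.
  by apply: contraNneq ze2 => <-.
(* The deleted end [z] is taken on a side that has a further vertex, so both sides survive; if
   neither side has one, $G$ has at most 3 vertices. *)
have [u /andP[uU uu1]|Uu1] := pickP (fun u => (u \in U) && (u != u1)).
  exists u1, u, w1; split => //; first by move: u1G; rewrite inE => /andP[].
  move: (subsetP UG _ uU) w1G; rewrite !inE !negb_or uu1 => /andP[-> ->] /andP[-> ->].
  by split => //; rewrite andbT; apply: contraNneq w1U => ->.
have [w /and3P[wU ww1 wG]|Ww1] :=
    pickP (fun w => [&& w \notin U, w != w1 & w \in verts G :\ x]).
  exists w1, u1, w; split => //; first by move: w1G; rewrite inE => /andP[].
  move: u1G wG; rewrite !inE !negb_or ww1 => /andP[-> ->] /andP[-> ->].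
  by split => //; rewrite andbT; apply: contraNneq w1U => <-.
suff : #|verts G| <= 3 by case: G3 => _; rewrite leqNgt ltnS => /negbTE->.
rewrite (cardsD1 x) xG ltnS; apply: (@leq_trans #|[set u1; w1]|).
  apply: subset_leq_card; apply/subsetP => v vG; rewrite !inE.
  have := Uu1 v; have := Ww1 v; rewrite vG andbT.
  by case: (v \in U) => /= [_|]; [move/negbFE-> | move/negbFE->; rewrite orbT].
by rewrite cards2; case: (_ == _).
Qed.

Lemma star_complement_degree x v : x \in verts G -> v \in verts G :\ x ->
  2 <= #|[set e in star_complement x | v \in ends G e]|.
Proof.
move=> xG vG; have := @two_crossing x [set v] xG; rewrite sub1set vG => /(_ isT).
have -> : [set v] != set0 by apply/set0Pn; exists v; rewrite inE.
have -> : (verts G :\ x) :\: [set v] != set0.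
  case: G3 => _; rewrite (cardsD1 x) xG (cardsD1 v) vG => c4 _.
  by rewrite -card_gt0; move: c4; card_lia.
move=> /(_ isT isT)/leq_trans; apply; apply: subset_leq_card.
apply/subsetP => e; rewrite !inE => /andP[-> /andP[/set0Pn[w]]].
by rewrite !inE => /andP[we /eqP<-].
Qed.

(** Each vertex of $G - x$ has two edges in the star complement, so losing [e] uncovers none. *)
Lemma shadow_star_complement_del x e : x \in verts G ->
  shadow (ends G) (star_complement x :\ e) = verts G :\ x.
Proof.
move=> xG; apply/setP => v; apply/shadowP/idP.
  case=> d; rewrite in_setD1 star_complementE => /and3P[_ dG xd] vd.
  by rewrite !inE (ends_verts dG vd) andbT; apply: contraNneq xd => <-.
move/(star_complement_degree xG)/card_gt1P => [d1 [d2 []]].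
rewrite inE => /andP[d1H d1v]; rewrite inE => /andP[d2H d2v] d12.
have [d1e|d1e] := eqVneq d1 e; last by exists d1; rewrite // in_setD1 d1e.
by exists d2; rewrite // in_setD1 d2H andbT -d1e eq_sym.
Qed.

Lemma shadow_star_complement x : x \in verts G ->
  shadow (ends G) (star_complement x) = verts G :\ x.
Proof.
move=> xG; apply/eqP; rewrite eqEsubset; apply/andP; split.
  apply/subsetP => v /shadowP[d]; rewrite star_complementE => /andP[dG xd] vd.
  by rewrite !inE (ends_verts dG vd) andbT; apply: contraNneq xd => <-.
apply/subsetP => v /(star_complement_degree xG)/ltnW/card_gt0P[d].
by rewrite inE => /andP[dH vd]; apply/shadowP; exists d.
Qed.

Lemma other_vert S : #|S| <= 3 -> exists2 x, x \in verts G & x \notin S.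
Proof.
move=> cS; apply/subsetPn; apply: contraL cS => /subset_leq_card.
by case: G3 => _ c4 _; rewrite -ltnNge; apply: leq_trans.
Qed.

Lemma shadow_edges : shadow (ends G) (edges G) = verts G.
Proof.
apply/eqP; rewrite eqEsubset shadow_verts //=; apply/subsetP => v vG.
have [|x xG] := @other_vert [set v]; first by rewrite cards1.
rewrite !inE => xv; apply: (subsetP (shadowS _ (star_complement_sub x))).
by rewrite shadow_star_complement // !inE eq_sym xv.
Qed.

(** A vertex other than [y] has an edge avoiding [y], so their stars differ. *)
Lemma incident_inj : {in verts G &, injective (incident G)}.
Proof.
move=> x y xG yG xy; apply/eqP; apply: contraT => neq.
have /ltnW/card_gt0P[e] : 2 <= #|[set e in star_complement y | x \in ends G e]|.
  by apply: star_complement_degree; rewrite // !inE neq.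
rewrite inE star_complementE => /andP[/andP[eG nye] xe].
have : e \in incident G y by rewrite -xy inE eG.
by rewrite inE (negbTE nye) andbF.
Qed.

Lemma edges_cover W :
  #|shadow (ends G) (edges G) :\: W| <= #|[set e in edges G | ~~ (ends G e \subset W)]|.
Proof.
apply: cover_of_degree => [e|v]; first exact: card_ends.
rewrite shadow_edges => vG; apply: leq_trans (leq_addr _ _).
have [|x xG] := @other_vert [set v]; first by rewrite cards1.
rewrite inE eq_sym => xv; have vGx : v \in verts G :\ x by rewrite !inE xv.
apply: leq_trans (star_complement_degree xG vGx) _; apply: subset_leq_card.
by apply/subsetP => e; rewrite 4!inE => /andP[/andP[_ ->] ->].
Qed.

(** With [U] the vertices of $G - x$ outside [W], at least [#|U| + 1] edges of the star complement
    meet a nonempty [U]; the extra one makes up for [e0]. *)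
Lemma star_complement_del_cover x e0 W :
  x \in verts G -> #|verts G| <= #|star_complement x| ->
  #|shadow (ends G) (star_complement x :\ e0) :\: W|
    <= #|[set e in star_complement x :\ e0 | ~~ (ends G e \subset W)]|.
Proof.
move=> xG cH; rewrite shadow_star_complement_del //.
set H := star_complement x in cH *; set U := (verts G :\ x) :\: W.
pose Z := [set e in H | ends G e :&: U != set0].
have HG : H \subset edges G := star_complement_sub x.
have [->|U0] := eqVneq U set0; first by rewrite cards0.
suff hZ : #|U| + 1 <= #|Z|.
  rewrite -(leq_add2r 1); apply: leq_trans hZ _.
  rewrite (cardsD1 e0) addnC; apply: leq_add; last by case: (_ \in _).
  apply: subset_leq_card; apply/subsetP => e; rewrite !in_setD1 !inE.
  case/and3P=> -> -> /set0Pn[v]; rewrite 2!inE => /and3P[ve vW _].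
  by apply/subsetPn; exists v.
have UG : U \subset verts G :\ x := subsetDl _ _.
(* If [U] is all of $V(G-x)$ there is no cut to use, but every edge of [H] meets [U] and [cH]
   provides [#|U| + 1] of them. *)
have [UE|UE] := eqVneq U (verts G :\ x).
  rewrite UE addn1 -[_.+1]/(true + _) -xG -cardsD1; apply: leq_trans cH _.
  apply: subset_leq_card; apply/subsetP => e eH; rewrite inE eH /=.
  move: eH; rewrite UE star_complementE => /andP[eG xe].
  have /andP[/card_gt0P[v ve] _] := card_ends eG.
  apply/set0Pn; exists v; rewrite !inE ve (ends_verts eG ve) andbT /=.
  by apply: contraNneq xe => <-.
(* Two crossing edges, halved in the degree count, give the one extra edge. *)
have cross : 2 <= #|crossing (ends G) H U|.
  apply: two_crossing => //.
  by rewrite setD_eq0; apply: contra UE => GU; rewrite eqEsubset UG.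
have : #|U| * 2 + #|crossing (ends G) H U| <= #|Z| * 2.
  apply: degree_crossing => [e /(subsetP HG)|v /(subsetP UG) vG]; first exact: card_ends.
  by apply: leq_trans (leq_addr _ _); apply: star_complement_degree.
by move: cross; card_lia.
Qed.

(** * Bases and circuits inside a star complement *)

Variable m : nat.
Local Notation M := (circular_matroid m.+1 G).

Lemma exists_basis : circuits M != set0 ->
  exists2 I : {set E}, independent M I & #|verts G| + m <= #|I|.
Proof.
move=> /set0Pn[C]; rewrite mem_circuits => /and3P[CG /eqP cC _].
have tC : #|shadow (ends G) C| + m <= #|C| by rewrite cC; card_lia.
have [I [IG sI]] := sparse_basis edges_cover CG tC.
by rewrite shadow_edges => cI; exists I; rewrite // independentE IG.
Qed.

(** The rank is at least [#|verts G| + m] by [exists_basis], so the corank bound on the star turns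
    into a lower bound on its complement. *)
Lemma card_star_complement x : circuits M != set0 -> x \in verts G ->
  num_incident G x <= corank M -> #|verts G| + m <= #|star_complement x|.
Proof.
move=> /exists_basis[I indI cI] xG; rewrite /corank /num_incident /= => hs.
have rI : #|I| <= rank M by apply: leq_bigmax_cond.
(* This covers the truncated subtraction in [corank]. *)
have IG : #|I| <= #|edges G|.
  by apply: subset_leq_card; case/andP: indI.
have sub : incident G x \subset edges G by apply/subsetP => e; rewrite inE => /andP[].
rewrite /star_complement cardsD (setIidPr sub).
by move: hs rI IG cI; generalize (rank M); card_lia.
Qed.

(** Even without [e] the star complement is tight and covers $V(G-x)$, so [sparse_basis] applies to
    it. The successor in the bound accounts for the missing vertex [x]. *)
Lemma star_complement_basis x e :
  x \in verts G -> e \in star_complement x -> #|verts G| + m <= #|star_complement x| ->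
  exists I : {set E}, [/\ I \subset star_complement x :\ e, independent M I &
                         #|verts G| + m <= #|I|.+1].
Proof.
move=> xG eH cH; have cV : #|verts G| = #|verts G :\ x|.+1 by rewrite (cardsD1 x) xG.
have cH1 : #|star_complement x| = #|star_complement x :\ e|.+1 by rewrite (cardsD1 e) eH.
have cov := star_complement_del_cover e _ xG (leq_trans (leq_addr _ _) cH).
have [|I [IH sI]] := @sparse_basis V E (ends G) m _ _ cov (subxx _).
  by rewrite shadow_star_complement_del //; move: cV cH1 cH; card_lia.
rewrite shadow_star_complement_del // => cI; exists I; split => //.
  rewrite independentE sI andbT; apply: subset_trans IH _.
  exact: subset_trans (subsetDl _ _) (subsetDl _ _).
by move: cV cI; card_lia.
Qed.

(** A basis avoiding [e] is already as large as the covered vertices allow; adding [e] creates a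
    circuit, which must use [e]. *)
Lemma star_complement_circuit x e :
  x \in verts G -> e \in star_complement x -> #|verts G| + m <= #|star_complement x| ->
  exists C, [/\ C \in circuits M, C \subset star_complement x & e \in C].
Proof.
move=> xG eH cH; have [I [IH indI cI]] := star_complement_basis xG eH cH.
have eI : e \notin I by apply/negP => /(subsetP IH); rewrite setD11.
have IeH : e |: I \subset star_complement x.
  by rewrite subUset sub1set eH (subset_trans IH) ?subsetDl.
have IeG := subset_trans IeH (star_complement_sub x).
have [|C CM CIe] := @circuit_in_dense _ _ G m (e |: I) IeG.
  apply/negP => /sparseP/(_ _ (subxx _)); rewrite cardsU1 eI.
  have := subset_leq_card (shadowS (ends G) IeH); rewrite shadow_star_complement //.
  by have := cardsD1 x (verts G); rewrite xG; move: cI; card_lia.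
exists C; split => //; first exact: subset_trans IeH.
apply: contraT => eC; case/andP: indI => _ /forall_inP/(_ C CM)/negP[].
apply/subsetP => d dC; have := subsetP CIe d dC; rewrite !inE => /orP[/eqP de|//].
by rewrite -de dC in eC.
Qed.

End ThreeConnected.

(** * Recovering the vertices from the matroid *)

(** Distinct stars make the matching of vertices injective and equal cardinalities make it onto;
    stars record all incidences, hence the ends of every edge. *)
Lemma matched_stars_iso (V V' E : finType) (G : mgraph V E) (G' : mgraph V' E) :
  edges G = edges G' -> verts G != set0 -> {in verts G &, injective (incident G)} ->
  #|verts G'| = #|verts G| ->
  {in verts G, forall x, exists2 x', x' \in verts G' & incident G' x' = incident G x} ->
  vertex_stars G = vertex_stars G' /\ strongly_isomorphic G G'.
Proof.
move=> EG /set0Pn[x0 x0G] injG cVV match_star.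
have [x0' _ _] := match_star _ x0G.
(* The default [x0'] is taken only outside [verts G]. *)
pose nu x := odflt x0' [pick x' in verts G' | incident G' x' == incident G x].
have nuP x : x \in verts G -> nu x \in verts G' /\ incident G' (nu x) = incident G x.
  move=> xG; rewrite /nu; case: pickP => [x' /andP[x'G /eqP] //|none].
  by have [x' x'G hx'] := match_star _ xG; move: (none x'); rewrite x'G hx' eqxx.
have nu_inj : {in verts G &, injective nu}.
  move=> x y xG yG nuxy; apply: injG => //.
  by rewrite -(nuP x xG).2 -(nuP y yG).2 nuxy.
have nuG : nu @: verts G = verts G'.
  apply/eqP; rewrite eqEcard card_in_imset // cVV leqnn andbT.
  by apply/subsetP => _ /imsetP[x xG ->]; case: (nuP x xG).
have nu_ends x e : e \in edges G -> x \in verts G ->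
    (nu x \in ends G' e) = (x \in ends G e).
  move=> eG xG; have [_ /setP/(_ e)] := nuP x xG.
  by rewrite !inE -EG eG.
have endsE e : e \in edges G -> ends G' e = nu @: ends G e.
  move=> eG; apply/setP => x'; apply/idP/imsetP.
    move=> x'e; have : x' \in verts G' by apply: ends_verts x'e; rewrite -EG.
    rewrite -nuG => /imsetP[x xG xE]; exists x => //.
    by rewrite -nu_ends // -xE.
  by case=> x xe ->; rewrite nu_ends // (ends_verts eG).
split; last first.
  split=> //; exists nu; split => // e eG x y xG yG; rewrite endsE //.
  split=> [->|]; first by rewrite imsetU !imset_set1.
  rewrite -imset_set1 -[X in _ :|: X]imset_set1 -imsetU => h.
  apply/setP => z; apply/idP/idP => hz.
    have zG := ends_verts eG hz.
    have : nu z \in nu @: [set x; y] by rewrite -h imset_f.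
    case/imsetP=> w wxy /nu_inj -> //.
    by move: wxy; rewrite !inE => /orP[] /eqP->.
  have : nu z \in nu @: ends G e by rewrite h imset_f.
  case/imsetP=> w we /nu_inj -> //; last exact: ends_verts we.
  by move: hz; rewrite !inE => /orP[] /eqP->.
rewrite /vertex_stars -nuG -imset_comp; apply: eq_in_imset => x xG /=.
by rewrite (nuP x xG).2.
Qed.

Theorem theorem5p8 (V V' E : finType) (k : nat)
    (G : mgraph V E) (G' : mgraph V' E)
    (hk : 1 <= k)
    (hG' : no_isolated G')
    (hG : three_connected G)
    (hcirc : circuits (circular_matroid k G) != set0)
    (hs : forall x, x \in verts G ->
            num_incident G x <= corank (circular_matroid k G))
    (hM : circular_matroid k G' = circular_matroid k G) :
  vertex_stars G = vertex_stars G' /\ strongly_isomorphic G G'.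
Proof.
case: k hk hcirc hs hM => // m _ hcirc hs hM.
have EG : edges G = edges G' by have := congr1 (@ground E) hM.
have cH x : x \in verts G -> #|verts G| + m <= #|star_complement G x|.
  by move=> xG; apply: card_star_complement (hs x xG).
have circH x e : x \in verts G -> e \in star_complement G x ->
    exists C, [/\ C \in circuits (circular_matroid m.+1 G),
                  C \subset star_complement G x & e \in C].
  by move=> xG eH; apply: star_complement_circuit (cH x xG).
have shadowG' : shadow (ends G') (edges G) = verts G'.
  apply/eqP; rewrite eqEsubset {1}EG shadow_verts //=; apply/subsetP => v vG'.
  have /set0Pn[e] := forall_inP hG' v vG'; rewrite inE -EG => /andP[eG ve].
  by apply/shadowP; exists e.
have [I0 indI0 cI0] := exists_basis hG hcirc.
have EG0 : edges G != set0.
  rewrite -card_gt0; have [|x xG _] := @other_vert _ _ G hG set0; first by rewrite cards0.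
  case/andP: indI0 => /subset_leq_card; have := cardsD1 x (verts G); rewrite xG /=.
  by move: cI0 => + + + _; card_lia.
have cVG : #|verts G'| = #|verts G|.
  (* Each inequality carries a large independent set of one graph into the other, where its size is
     bounded by the vertex count plus [m]. *)
  apply/eqP; rewrite eqn_leq; apply/andP; split.
    have EGs : edges G \subset edges G' by rewrite EG.
    have [e eG|I [IG]] := @circuit_union_basis _ _ G' m _ EGs EG0.
      (* An edge has at most two ends, so it lies in some star complement and there in a circuit. *)
      have /andP[_ ce] := card_ends eG; have [|x xG xe] := @other_vert _ _ G hG (ends G e).
        exact: leq_trans ce _.
      have [|C [CM CH eC]] := circH x e xG; first by rewrite star_complementE eG.
      by exists C; rewrite hM; split => //; apply: subset_trans (star_complement_sub G x).
    rewrite shadowG' hM => /independent_card cI cI'.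
    by have := subset_leq_card (shadow_verts IG); move: cI cI'; card_lia.
  have := indI0; rewrite -hM => /independent_card.
  have : shadow (ends G') I0 \subset verts G'.
    by apply: shadow_verts; rewrite -EG; case/andP: indI0.
  by move/subset_leq_card; move: cI0; card_lia.
apply: matched_stars_iso => //; [|exact: incident_inj|].
  have [|x xG _] := @other_vert _ _ G hG set0; first by rewrite cards0.
  by apply/set0Pn; exists x.
move=> x xG; set H := star_complement G x.
have HG : H \subset edges G' by rewrite -EG star_complement_sub.
have [e0 e0H] : exists e0, e0 \in H.
  apply/set0Pn; rewrite -card_gt0; apply: leq_trans (cH x xG).
  by rewrite (cardsD1 x) xG.
have cV : #|verts G| = #|verts G :\ x|.+1 by rewrite (cardsD1 x) xG.
(* In $G'$ a basis of [H] has at least [#|shadow (ends G') H| + m] edges, in $G$ at most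
   [#|verts G :\ x| + m]. *)
have shH' : #|shadow (ends G') H| < #|verts G|.
  have [|e eH|I [IH]] := @circuit_union_basis _ _ G' m H HG.
  - by apply/set0Pn; exists e0.
  - by rewrite hM; apply: circH.
  rewrite hM => /independent_card cI cI'.
  have := subset_leq_card (shadowS (ends G) IH).
  rewrite shadow_star_complement //; move: cV cI cI'; card_lia.
(* Conversely, a basis of [H] found in $G$ is too large for fewer vertices of $G'$; so exactly one
   vertex [x'] is missed. *)
have cH' : #|verts G'| = #|shadow (ends G') H|.+1.
  have [I [IH indI cI]] := star_complement_basis hG xG e0H (cH x xG).
  have := indI; rewrite -hM => /independent_card.
  have : #|shadow (ends G') I| <= #|shadow (ends G') H|.
    by apply/subset_leq_card/shadowS/(subset_trans IH)/subsetDl.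
  by rewrite cVG; move: shH' cI; card_lia.
have sH' := shadow_verts HG.
have /cards1P[x' x'E] : #|verts G' :\: shadow (ends G') H| == 1.
  by rewrite cardsD (setIidPr sH') cH' subSnn.
have [x'H x'G] : x' \notin shadow (ends G') H /\ x' \in verts G'.
  by apply/andP; rewrite -in_setD x'E set11.
exists x' => //; apply/setP => e; rewrite !inE -EG.
case eG: (e \in edges G) => //=; apply/idP/idP => [x'e|xe].
  apply: contraNT x'H => xe; apply/shadowP; exists e => //.
  by rewrite star_complementE eG.
(* For [e] at [x], the set [e |: I] is independent because [x] is a new vertex. If [e] avoided [x']
   in $G'$, its at least [#|verts G| + m] edges would lie on [#|verts G| - 1] vertices. *)
have [I [IH indI cI]] := star_complement_basis hG xG e0H (cH x xG).
have [IG sI] : I \subset edges G /\ sparse (ends G) m I.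
  by apply/andP; rewrite -independentE.
have eIG : e |: I \subset edges G by rewrite subUset sub1set eG.
have xI : x \notin shadow (ends G) I.
  have : I \subset H := subset_trans IH (subsetDl _ _).
  move/(shadowS (ends G))/subsetP/(_ x)/contra; apply.
  by rewrite shadow_star_complement // setD11.
have : independent (circular_matroid m.+1 G') (e |: I).
  by rewrite hM independentE eIG (sparse_setU1 sI xe xI).
move/independent_card; rewrite cardsU1.
have -> : e \notin I by apply: contra xI => eI; apply/shadowP; exists e.
apply: contraTT => x'e; rewrite -ltnNge.
have sub : shadow (ends G') (e |: I) \subset verts G' :\ x'.
  rewrite subsetD1 shadow_verts -?EG // shadowU shadow1 inE negb_or x'e /=.
  apply: contra x'H; apply: subsetP; apply: shadowS.
  exact: subset_trans IH (subsetDl _ _).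
have := subset_leq_card sub; have := cardsD1 x' (verts G'); rewrite x'G cVG.
by move: cI; card_lia.
Qed.
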